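(* Let $n\geq 3$ and let $A=\{a_1,\dots,a_k\}$ be either the set of all points of $E^n$ of even weight or the set of all points of $E^n$ of odd weight. Then for every $f\in M(A)$, the set $R_f=E^n-S_{A,(f(a_1),\dots,f(a_k))}$ is an antichain in $E^n$, so that the term $D(R_f)$ in $$D_n=\sum_{f\in M(A)} D\bigl(E^n-S_{A,(f(a_1),\dots,f(a_k))}\bigr)$$ equals $2^{|R_f|}$; i.e. $D_n$ is a sum of powers of $2$.
   Context: $E=\{0,1\}$ with $0\leq 1$; $E^n$ is the set of $n$-tuples over $E$ with the componentwise order; the weight $|a|$ of $a\in E^n$ is its number of $1$s. Monotone Boolean functions $f:E^n\to E$ satisfy $a\leq b\Rightarrow f(a)\leq f(b)$. For $T\subseteq E^n$, $M(T)$ is the set of distinct restrictions $f|_T$ of monotone Boolean functions on $E^n$, $D(T)=|M(T)|$, and $D_n=D(E^n)$ is the $n$-th Dedekind number. $S_{a,1}=\{b\in E^n: b\geq a\}$, $S_{a,0}=\{b\in E^n: b\leq a\}$, and for $A=\{a_1,\dots,a_k\}$, $y\in E^k$, $S_{A,y}=\bigcup_i S_{a_i,y^i}$. An antichain is a set of pairwise incomparable elements. *)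

(* Defs.v *)
From mathcomp Require Import all_boot all_order.

Set Implicit Arguments.
Unset Strict Implicit.
Unset Printing Implicit Defensive.

(* n.-tupleprod carries the componentwise order (see Order.Theory.leEtprod);
   bool is ordered by false <= true. *)
Definition E (n : nat) := n.-tupleprod bool.

Definition weight (n : nat) (a : E n) : nat := #|[set i : 'I_n | tnth a i]|.

Definition evens (n : nat) : {set E n} := [set a | ~~ odd (weight a)].
Definition odds (n : nat) : {set E n} := [set a | odd (weight a)].

Definition monotone (n : nat) (f : {ffun E n -> bool}) : bool :=
  [forall a, forall b, (a <= b)%O ==> (f a <= f b)%O].

Definition restr (n : nat) (T : {set E n}) (f : {ffun E n -> bool}) :
    {ffun {a | a \in T} -> bool} :=
  [ffun a => f (val a)].

Definition M (n : nat) (T : {set E n}) : {set {ffun {a | a \in T} -> bool}} :=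
  [set restr T f | f in [pred f | monotone f]].

Definition D (n : nat) (T : {set E n}) : nat := #|M T|.

Definition dedekind (n : nat) : nat := D [set: E n].

Definition shadow1 (n : nat) (a : E n) (e : bool) : {set E n} :=
  if e then [set b | (a <= b)%O] else [set b | (b <= a)%O].

(* S_{A,y}, the union of the S_{a_i,y^i} = shadow1 a_i y^i.
   The vector y in E^k of values attached to A = {a_1, ..., a_k} is indexed by
   the elements of A themselves, so that no enumeration of A is chosen and the
   vector (f(a_1), ..., f(a_k)) of f \in M A is f itself. *)
Definition shadow (n : nat) (A : {set E n}) (y : {ffun {a | a \in A} -> bool}) :
    {set E n} :=
  \bigcup_(a : {a | a \in A}) shadow1 (val a) (y a).

Definition antichain (n : nat) (T : {set E n}) : Prop :=
  {in T &, forall a b, a != b -> ~~ (a >=< b)%O}.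

Definition residue (n : nat) (A : {set E n}) (f : {ffun {a | a \in A} -> bool}) :
    {set E n} :=
  [set: E n] :\: shadow f.

(* Main.v *)
(** A monotone function is forced on the shadow of its restriction to [A], and
    any monotone function may replace it on the residue, so the fibre of the
    restriction map over [f] is [M (residue f)]; this gives the decomposition of
    the Dedekind number for every [A]. If [A] is a parity class, two comparable
    points of the residue both lie outside [A]; flipping one bit of the smaller
    one gives a point of [A] between them, whose value puts one of the two in
    the shadow. *)

Require Import Defs.
From mathcomp Require Import all_boot all_order.

Set Implicit Arguments.
Unset Strict Implicit.
Unset Printing Implicit Defensive.

Import Order.TTheory.

Lemma le_bool_implyb (x y : bool) : (x <= y)%O = (x ==> y).
Proof. by case: x; case: y. Qed.

Lemma monotoneP (n : nat) (f : {ffun E n -> bool}) :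
  reflect (forall a b : E n, (a <= b)%O -> f a -> f b) (monotone f).
Proof.
apply: (iffP forallP) => [mf a b ab | mf a].
  by have /forallP/(_ b)/implyP/(_ ab) := mf a; rewrite le_bool_implyb => /implyP.
by apply/forallP => b; apply/implyP => ab; rewrite le_bool_implyb; apply/implyP/mf.
Qed.

Lemma restrP (n : nat) (T : {set E n}) (f g : {ffun E n -> bool}) :
  restr T f = restr T g <-> {in T, f =1 g}.
Proof.
split=> [/ffunP fg a aT | fg]; first by have := fg (exist _ a aT); rewrite !ffunE.
by apply/ffunP => -[a aT]; rewrite !ffunE; apply: fg.
Qed.

Lemma dedekindE (n : nat) :
  dedekind n = #|[set f : {ffun E n -> bool} | monotone f]|.
Proof.
rewrite /dedekind /D /M card_imset ?cardsE // => f g /restrP fg.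
by apply/ffunP => a; apply: fg; rewrite inE.
Qed.

Section Shadow.
Variables (n : nat) (A : {set E n}).
Implicit Types (f g : {ffun E n -> bool}) (a b x : E n).

Lemma mem_shadow_restr f x :
  (x \in shadow (restr A f)) =
  [exists a in A, if f a then (a <= x)%O else (x <= a)%O].
Proof.
apply/bigcupP/exists_inP => [[[a aA] _] | [a aA ax]].
  by rewrite ffunE /= => xa; exists a => //; move: xa; case: (f a); rewrite inE.
exists (exist _ a aA) => //; rewrite ffunE /=.
by move: ax; case: (f a); rewrite inE.
Qed.

Lemma mem_residue (y : {ffun {a | a \in A} -> bool}) x :
  (x \in residue y) = (x \notin shadow y).
Proof. by rewrite !inE andbT. Qed.

Lemma sub_shadow_restr f : A \subset shadow (restr A f).
Proof.
apply/subsetP => a aA; rewrite mem_shadow_restr.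
by apply/exists_inP; exists a => //; rewrite lexx if_same.
Qed.

(** A point of the shadow lies above some [a] in [A] of value 1 or below one of value 0;
    monotonicity then dictates the value there. *)
Lemma eq_on_shadow f g : monotone f -> monotone g ->
  restr A f = restr A g -> {in shadow (restr A g), f =1 g}.
Proof.
move=> /monotoneP mf /monotoneP mg /restrP fg x.
rewrite mem_shadow_restr => /exists_inP[a aA]; have fga := fg a aA.
case ga: (g a) => ax; first by rewrite (mf a x) ?(mg a x) ?fga.
by apply/idP/idP => [/(mf _ _ ax) | /(mg _ _ ax)]; rewrite ?fga ga.
Qed.

(** Only pairs [a <= b] split between residue and shadow need care. The point [c] of [A] that
    shadows one of the two either forces [f b = 1] or [f a = 0], or else shadows the other one as
    well, which is excluded. *)
Lemma monotone_patch f h : monotone f -> monotone h ->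
  monotone [ffun x => if x \in residue (restr A f) then h x else f x].
Proof.
move=> /monotoneP mf /monotoneP mh; apply/monotoneP => a b ab.
rewrite !ffunE !mem_residue.
have [aR | /negPn] := ifPn (a \notin _); have [bR | /negPn] := ifPn (b \notin _).
- exact: mh.
- rewrite mem_shadow_restr => /exists_inP[c cA].
  case fc: (f c); first by move=> cb _; apply: mf cb _.
  move=> bc; case/negP: aR; rewrite mem_shadow_restr; apply/exists_inP; exists c => //.
  by rewrite fc (le_trans ab).
- rewrite mem_shadow_restr => /exists_inP[c cA].
  case fc: (f c); last by move=> ac /(mf _ _ ac); rewrite fc.
  move=> ca; case/negP: bR; rewrite mem_shadow_restr; apply/exists_inP; exists c => //.
  by rewrite fc (le_trans ca).
- by move=> _ _; apply: mf.
Qed.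

(** Restriction to the residue is a bijection from the fibre onto [M R]: patching gives
    surjectivity, agreement on the shadow gives injectivity. *)
Lemma card_restr_fiber f : monotone f ->
  #|[set g | monotone g & restr A g == restr A f]| = D (residue (restr A f)).
Proof.
move=> mf; set R := residue _; rewrite /D.
have -> : M R = restr R @: [set g | monotone g & restr A g == restr A f].
  apply/setP => r; apply/imsetP/imsetP => [] [g]; last first.
    by rewrite inE => /andP[mg _] ->; exists g.
  rewrite inE => mg ->; exists [ffun x => if x \in R then g x else f x].
    rewrite inE monotone_patch //=; apply/eqP/restrP => a aA.
    by rewrite ffunE mem_residue (subsetP (sub_shadow_restr f)).
  by apply/restrP => a aR; rewrite ffunE aR.
rewrite card_in_imset // => g h; rewrite !inE.
move=> /andP[mg /eqP gf] /andP[mh /eqP hf] /restrP gh; apply/ffunP => x.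
have [xR | ] := boolP (x \in R); first exact: gh.
by rewrite mem_residue negbK => xS; rewrite !(eq_on_shadow _ mf _ xS).
Qed.

Lemma dedekind_sum_residue : dedekind n = \sum_(y in M A) D (residue y).
Proof.
rewrite dedekindE cardsE -sum1_card (partition_big_imset (restr A)) /=.
apply: eq_bigr => y /imsetP[f mf ->].
by rewrite -card_restr_fiber // -sum1_card; apply: eq_bigl => g; rewrite !inE.
Qed.

End Shadow.

Lemma D_antichain (n : nat) (T : {set E n}) : antichain T -> D T = 2 ^ #|T|.
Proof.
move=> acT; suff -> : D T = #|{ffun {a | a \in T} -> bool}|.
  by rewrite card_ffun card_bool card_sig.
rewrite /D -cardsT; congr #|pred_of_set _|; apply/setP => h; rewrite [RHS]inE.
(* The least monotone extension of [h]: the indicator of the up-set generated by the points where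
   [h] is 1. On an antichain it adds no further point of [T]. *)
apply/imsetP; exists [ffun x => [exists t, h t && (val t <= x)%O]].
  apply/monotoneP => a b ab; rewrite !ffunE => /existsP[t /andP[ht ta]].
  by apply/existsP; exists t; rewrite ht (le_trans ta).
apply/ffunP => t; rewrite !ffunE.
apply/idP/existsP => [ht | [u /andP[hu ut]]]; first by exists t; rewrite ht lexx.
have [<- // | neq] := eqVneq u t.
by case/negP: (acT _ _ (valP u) (valP t) neq); rewrite /Order.comparable ut.
Qed.

Lemma weight_flip (n : nat) (a b : E n) : (a <= b)%O -> a != b ->
  exists c : E n, [/\ (a <= c)%O, (c <= b)%O & weight c = (weight a).+1].
Proof.
rewrite leEtprod => /forallP ab neq.
have [i /andP[ai bi]] : exists i, ~~ tnth a i && tnth b i.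
  apply/existsP; apply: contraNT neq => /existsPn nab; apply/eqP/eq_from_tnth => i.
  by have := ab i; have := nab i; case: (tnth a i); case: (tnth b i).
(* [c] is [a] with bit [i] switched on, where [a] has 0 and [b] has 1. *)
pose c : E n := [tuple (j == i) || tnth a j | j < n].
exists c; split.
- rewrite leEtprod; apply/forallP => j; rewrite tnth_mktuple le_bool_implyb.
  by apply/implyP => ->; rewrite orbT.
- rewrite leEtprod; apply/forallP => j; rewrite tnth_mktuple le_bool_implyb.
  by apply/implyP => /orP[/eqP -> // | aj]; have := ab j; rewrite aj le_bool_implyb.
rewrite /weight -[RHS]add1n; set s := (X in _ = 1 + #|pred_of_set X|).
have <- : i \notin s = 1 :> nat by rewrite inE ai.
rewrite -cardsU1; congr #|pred_of_set _|.
by apply/setP => j; rewrite !inE tnth_mktuple.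
Qed.

Lemma antichain_residue (n : nat) (A : {set E n}) :
  A = evens n \/ A = odds n -> forall f, f \in M A -> antichain (residue f).
Proof.
move=> hA _ /imsetP[f _ ->].
have disjA (x : E n) : x \in residue (restr A f) -> x \notin A.
  by rewrite mem_residue; apply/contraNN/subsetP/sub_shadow_restr.
have lt_absurd (a b : E n) : a \in residue (restr A f) ->
    b \in residue (restr A f) -> a != b -> (a <= b)%O -> False.
  move=> aR bR neq ab; have [c [ac cb wc]] := weight_flip ab neq.
  (* [a] is outside [A], and [c] has the opposite parity. *)
  have cA : c \in A.
    by have := disjA _ aR; case: hA => ->; rewrite !inE wc /= ?negbK.
  (* If [f c = 1], then [c <= b] puts [b] in the shadow; if [f c = 0], then [a <= c] puts [a]
     there. *)
  move: aR bR; rewrite !mem_residue !mem_shadow_restr => /exists_inPn/(_ c cA).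
  by move=> ha /exists_inPn/(_ c cA); move: ha; case: (f c); rewrite ?ac ?cb.
move=> a b aR bR neq; apply/negP => /orP[]; first exact: lt_absurd.
by apply: lt_absurd => //; rewrite eq_sym.
Qed.

Theorem theorem4 (n : nat) (A : {set E n}) (hn : 3 <= n)
    (hA : A = evens n \/ A = odds n) :
  [/\ forall f, f \in M A -> antichain (residue f),
      forall f, f \in M A -> D (residue f) = 2 ^ #|residue f|,
      dedekind n = \sum_(f in M A) D (residue f)
    & dedekind n = \sum_(f in M A) 2 ^ #|residue f|].
Proof.
have acR := antichain_residue hA.
have DR f (fM : f \in M A) := D_antichain (acR f fM).
split=> //; first exact: dedekind_sum_residue.
by rewrite (dedekind_sum_residue A); apply: eq_bigr.
Qed.
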